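(* Let $(M,d)$ be a complete pointed metric space, let $E\subset\mathcal{R}(M)$ be Borel and closed with respect to $\bar{d}$, and let $i\in\{1,2\}$. Then $\mathcal{R}\cap p_i^{-1}(E)$ belongs to $\mathfrak{C}$; that is, whenever $\mu,\nu$ are positive Radon measures on $\beta\widetilde{M}$ with $\mu\preccurlyeq\nu$ and $\nu$ concentrated on $\mathcal{R}\cap p_i^{-1}(E)$, then $\mu$ is concentrated on $\mathcal{R}\cap p_i^{-1}(E)$.
   Context: $\mathrm{Lip}_0(M)$: Lipschitz $f:M\to\mathbb{R}$ with $f(0)=0$ ($0$ the base point), normed by the Lipschitz constant. $\widetilde{M}=\{(x,y)\in M\times M:x\ne y\}$, $\beta\widetilde{M}$ its Stone–Čech compactification; Radon measures identified with $C(\beta\widetilde{M})^*$. $M^u$ is the uniform (Samuel) compactification of $M$; $p_1,p_2:\beta\widetilde{M}\to M^u$ continuously extend the coordinate projections, $p=(p_1,p_2)$. $\mathcal{R}(M)=\{\xi\in M^u:\overline{d_0}(\xi)<\infty\}$, where $\overline{d_0}:M^u\to[0,\infty]$ continuously extends $x\mapsto d(x,0)$, with the subspace topology; every $f\in\mathrm{Lip}_0(M)$ extends uniquely to a continuous $f^{\mathcal{R}}:\mathcal{R}(M)\to\mathbb{R}$, and $\bar d(\xi,\eta)=\sup\{|f^{\mathcal{R}}(\xi)-f^{\mathcal{R}}(\eta)|: f\in\mathrm{Lip}_0(M),\ \mathrm{Lip}(f)\le1\}$ is a metric on $\mathcal{R}(M)$ extending $d$; ''Borel'' refers to the topology of $\mathcal{R}(M)$.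 $\mathcal{R}=p^{-1}(\mathcal{R}(M)\times\mathcal{R}(M))$. $G$ is the set of $g\in C(\beta\widetilde{M})$ with $d(x,y)g(x,y)\le d(x,u)g(x,u)+d(u,y)g(u,y)$ for all distinct $x,u,y\in M$; $\mu\preccurlyeq\nu$ iff $\int g\,d\mu\le\int g\,d\nu$ for all $g\in G$. $\mathfrak{C}$ is the family of Borel $C\subset\beta\widetilde{M}$ such that for positive $\mu,\nu$ with $\mu\preccurlyeq\nu$ and $\nu$ concentrated on $C$, $\mu$ is concentrated on $C$. Throughout, $M$ has at least three distinct points. *)

(* Defs.v *)
From HB Require Import structures.
From mathcomp Require Import all_boot all_order all_algebra.
From mathcomp Require Import all_classical all_reals all_analysis.
Set Implicit Arguments. Unset Strict Implicit. Unset Printing Implicit Defensive.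
Import Order.TTheory GRing.Theory Num.Theory.
Local Open Scope classical_set_scope.
Local Open Scope ring_scope.

Section Defs.
Context {R : realType} {M : metricType R}.

Local Notation d := (@mdist R M).

Definition Mtil_set : set (M * M) := [set p | p.1 <> p.2].
Notation Mtil := (set_type Mtil_set).

Definition Cb (f : Mtil -> R) : Prop :=
  continuous (f : Mtil -> R^o) /\ exists C : R, forall z, `|f z| <= C.

Definition UCb (h : M -> R) : Prop :=
  (exists C : R, forall x, `|h x| <= C) /\
  (forall e : R, 0 < e -> exists2 del : R, 0 < del &
     forall x y, d x y < del -> `|h x - h y| < e).

(** characters (nonzero multiplicative linear functionals) of the unital
    algebra S of real functions on T; normalised to vanish outside S so that
    each character has a unique representative. *)
Definition is_char {T : Type} (S : (T -> R) -> Prop) (phi : (T -> R) -> R) : Prop :=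
  [/\ phi (fun _ => 1) = 1,
      forall f g, S f -> S g -> phi (fun z => f z + g z) = phi f + phi g,
      forall (c : R) f, S f -> phi (fun z => c * f z) = c * phi f,
      forall f g, S f -> S g -> phi (fun z => f z * g z) = phi f * phi g
    & forall f, ~ S f -> phi f = 0].

(** beta M~ : Gelfand spectrum of C_b(M~) with the weak-star (pointwise)
    topology; this is the Stone-Cech compactification of M~. *)
Definition betaM_set : set {ptws (Mtil -> R) -> R^o} := is_char Cb.
Notation betaM := (set_type betaM_set).

(** M^u : Gelfand spectrum of the bounded uniformly continuous functions
    with the weak-star topology (uniform / Samuel compactification of M). *)
Definition Mu_set : set {ptws (M -> R) -> R^o} := is_char UCb.
Notation Mu := (set_type Mu_set).

Definition is_ev_beta (a : betaM) (x y : M) : Prop :=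
  forall z : Mtil, set_val z = (x, y) ->
  forall f, Cb f -> (set_val a : (Mtil -> R) -> R) f = f z.

Definition is_ev_Mu (a : Mu) (x : M) : Prop :=
  forall h, UCb h -> (set_val a : (M -> R) -> R) h = h x.

(** p_i : beta M~ -> M^u, the continuous extension of the i-th coordinate
    projection (i = 1 or 2), given by its graph: p_i(phi) = xi iff
    xi(h) = phi(h o pi_i) for every h in C(M^u). *)
Definition coord (i : nat) (p : M * M) : M := if i == 1%N then p.1 else p.2.
Definition proj_graph (i : nat) (phi : betaM) (xi : Mu) : Prop :=
  forall h, UCb h ->
    (set_val xi : (M -> R) -> R) h =
    (set_val phi : (Mtil -> R) -> R) (fun z : Mtil => h (coord i (set_val z))).

(** \bar{d_0} : M^u -> [0,oo], continuous extension of x |-> d(x,0):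
    obtained from the extension of the bounded uniformly continuous function
    x |-> d(x,0)/(1+d(x,0)) composed with the inverse homeomorphism
    s |-> s/(1-s) from [0,1] onto [0,oo]. *)
Definition dbar0 (x0 : M) (xi : Mu) : \bar R :=
  let s := (set_val xi : (M -> R) -> R) (fun x => d x x0 / (1 + d x x0)) in
  if s < 1 then (s / (1 - s))%:E else +oo%E.

Definition RM (x0 : M) : set Mu := [set xi | (dbar0 x0 xi < +oo)%E].

Definition Lip0_le1 (x0 : M) (f : M -> R) : Prop :=
  f x0 = 0 /\ forall x y, `|f x - f y| <= d x y.

(** \bar d on R(M): sup of |f^R(xi) - f^R(eta)| over 1-Lipschitz f in
    Lip_0(M), where f^R is the (unique) continuous extension of f to R(M). *)
Definition dbar (x0 : M) (xi eta : Mu) : \bar R :=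
  ereal_sup [set (`|F xi - F eta|)%:E | F in
    [set F : Mu -> R | exists f, Lip0_le1 x0 f /\
        {within RM x0, continuous (F : Mu -> R^o)} /\
        (forall (a : Mu) x, RM x0 a -> is_ev_Mu a x -> F a = f x)]].

Definition Borel_in_RM (x0 : M) (E : set Mu) : Prop :=
  E `<=` RM x0 /\ <<s RM x0, [set RM x0 `&` U | U in @open Mu] >> E.

Definition dbar_closed (x0 : M) (E : set Mu) : Prop :=
  E `<=` RM x0 /\
  forall xi, RM x0 xi ->
    (forall e : R, 0 < e -> exists2 eta, E eta & (dbar x0 xi eta < e%:E)%E) ->
    E xi.

Definition Rcal (x0 : M) : set betaM :=
  [set phi | exists xi1 xi2, [/\ proj_graph 1 phi xi1, proj_graph 2 phi xi2,
                                 RM x0 xi1 & RM x0 xi2]].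

Definition preim_p (i : nat) (E : set Mu) : set betaM :=
  [set phi | exists2 xi, proj_graph i phi xi & E xi].

(** Borel sigma-algebra of beta M~.  MathComp-Analysis requires a pointed
    carrier for measurable types; beta M~ is nonempty (M has >= 2 points) but
    we cannot exhibit a point here without hypotheses, so we take the base point
    [pt] as a (mathematically irrelevant) parameter of the carrier alias. *)
Definition betaP (pt : betaM) : Type := betaM.
HB.instance Definition _ (pt : betaM) := Choice.on (betaP pt).
HB.instance Definition _ (pt : betaM) := isPointed.Build (betaP pt) pt.
Notation betaB pt := (g_sigma_algebraType (T := betaP pt) (@open betaM)).

(** positive Radon measures on beta M~ : finite Borel measures, inner regular
    by compact sets (= regular, for finite measures on a compact space). *)
Definition is_Radon (pt : betaM) (mu : {measure set betaB pt -> \bar R}) : Prop :=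
  (mu setT < +oo)%E /\
  forall B : set (betaB pt), measurable B ->
    mu B = ereal_sup [set mu K | K in [set K : set (betaB pt) |
                        @compact betaM K /\ K `<=` B]].

Definition Gset : set (betaM -> R) :=
  [set g | continuous (g : betaM -> R^o) /\
     forall (x u y : M) (a b c : betaM),
       x <> u -> u <> y -> x <> y ->
       is_ev_beta a x y -> is_ev_beta b x u -> is_ev_beta c u y ->
       d x y * g a <= d x u * g b + d u y * g c].

Definition prec (pt : betaM) (mu nu : {measure set betaB pt -> \bar R}) : Prop :=
  forall g, Gset g ->
    (\int[mu]_z (g z)%:E <= \int[nu]_z (g z)%:E)%E.

Definition frakC (pt : betaM) (C : set (betaB pt)) : Prop :=
  measurable C /\
  forall mu nu : {measure set betaB pt -> \bar R},
    is_Radon mu -> is_Radon nu -> prec mu nu ->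
    nu (~` C) = 0%E -> mu (~` C) = 0%E.

End Defs.

(* Main.v *)
(* For a nonnegative 1-Lipschitz k on M, the function min(1, k(x) / d(x,y)), or
   the same with k(y), lies in G: multiplied by d(x,y) it is min(d(x,y), k(x)),
   which satisfies the triangle inequality.  Given compact sets K_n inside
   C = R cap p_i^-1(E) carrying nu up to 1/(n+1), it is enough to find such
   functions vanishing on K_n and bounded below, uniformly in n, on a given set
   A: then mu(A) = 0.
   For A the complement of R, take k = (d(.,0) - N)^+ with N large, adding the
   functions for both coordinates.
   For the part of R outside p_i^-1(E), a point xi off E is at positive
   dbar-distance from E, so each eta in E is separated from xi by a 1-Lipschitz
   u : M -> [0,1] with u(eta) = 0 and u(xi) bounded below independently of eta.
   Finite minima and maxima make u uniform over K_n and over a compact set of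
   points xi, and k = (u - r)^+ vanishes near p_i(K_n).  The points so
   separated, for a fixed r and all n, form a G_delta set, to which the inner
   regularity of mu applies. *)
Require Import Defs.
From HB Require Import structures.
From mathcomp Require Import all_boot all_order all_algebra.
From mathcomp Require Import all_classical all_reals all_analysis.
From mathcomp Require Import measurable_realfun ring lra.
Set Implicit Arguments. Unset Strict Implicit. Unset Printing Implicit Defensive.
Import Order.TTheory GRing.Theory Num.Theory numFieldNormedType.Exports.
Local Open Scope classical_set_scope.
Local Open Scope ring_scope.

(** * Characters of inverse-closed function algebras *)

(** Closure under inverses of functions bounded away from 0 is what makes every character a limit
    along a filter on [T]. *)
Record inv_closed_alg {R : realType} {T : Type} (S : (T -> R) -> Prop) : Prop := {
  ica_cst : forall c : R, S (fun=> c);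
  ica_add : forall f g, S f -> S g -> S (fun x => f x + g x);
  ica_mul : forall f g, S f -> S g -> S (fun x => f x * g x);
  ica_inv : forall f (e : R), 0 < e -> S f -> (forall x, e <= f x) ->
    S (fun x => (f x)^-1) }.

Section Characters.
Context {R : realType} {T : Type} (S : (T -> R) -> Prop).
Hypothesis S_alg : inv_closed_alg S.
Variable phi : (T -> R) -> R.
Hypothesis phi_char : is_char S phi.

Lemma char_cst (c : R) : phi (fun=> c) = c.
Proof.
have [p1 _ pZ _ _] := phi_char.
rewrite -[RHS]mulr1 -p1 -pZ; last exact: ica_cst.
by congr phi; apply/funext => x; rewrite mulr1.
Qed.

(* A nonnegative element of the kernel is not bounded below by a positive
   constant, since otherwise it would be invertible in the algebra. *)
Lemma char_cvg : exists F : set_system T,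
  ProperFilter F /\ forall f, S f -> f @ F --> phi f.
Proof.
have [p1 pD pZ pM _] := phi_char.
pose D := [set p : (T -> R) * R |
  [/\ S p.1, forall x, 0 <= p.1 x, phi p.1 = 0 & 0 < p.2]].
pose B (p : (T -> R) * R) := [set x | p.1 x < p.2].
have FP : ProperFilter (filter_from D B).
  apply: filter_from_proper.
    apply: filter_from_filter.
      by exists (fun=> 0, 1); split => //=; [exact: ica_cst|exact: char_cst].
    move=> [f a] [g b] [/= Sf f0 pf a0] [/= Sg g0 pg b0].
    exists (fun x => f x + g x, Num.min a b).
      split => /=; first exact: ica_add.
      - by move=> x; rewrite addr_ge0.
      - by rewrite pD// pf pg addr0.
      - by rewrite lt_min a0.
    move=> x; rewrite /B /= lt_min => /andP[fa gb]; split.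
      by apply: le_lt_trans fa; rewrite lerDl.
    by apply: le_lt_trans gb; rewrite lerDr.
  move=> [f e] [/= Sf f0 pf e0]; apply/set0P/eqP => B0.
  have fe x : e <= f x.
    rewrite leNgt; apply/negP => fxe.
    by have : B (f, e) x by []; rewrite B0.
  have := pM _ _ Sf (ica_inv S_alg e0 Sf fe); rewrite pf mul0r.
  rewrite (_ : (fun z => _) = (fun=> 1)); last first.
    by apply/funext => x; rewrite mulfV// gt_eqF// (lt_le_trans e0).
  by rewrite p1 => /eqP; rewrite oner_eq0.
exists (filter_from D B); split => // f Sf; apply/cvgrPdist_lt => e e0.
have Sg : S (fun x => f x + - phi f) by apply: ica_add => //; exact: ica_cst.
(* The square of [f - phi f] is nonnegative and lies in the kernel; where it is below [e ^+ 2], [f]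
   is within [e] of [phi f]. *)
exists ((fun x => (f x + - phi f) * (f x + - phi f)), e ^+ 2); last first.
  move=> x; rewrite /B/= -expr2 => fxe.
  by rewrite distrC -(ltr_pXn2r (ltn0Sn 1)) ?nnegrE ?normr_ge0 ?(ltW e0)// real_normK// num_real.
split => /=.
- exact: ica_mul.
- by move=> x; rewrite -expr2 sqr_ge0.
- rewrite pM// pD//; last exact: ica_cst.
  by rewrite char_cst subrr mulr0.
- by rewrite exprn_gt0.
Qed.

Lemma char_le (f g : T -> R) : S f -> S g -> (forall x, f x <= g x) ->
  phi f <= phi g.
Proof.
move=> Sf Sg fg; have [F [FF Fcvg]] := char_cvg.
rewrite leNgt; apply/negP => gf.
pose m := (phi f + phi g) / 2.
have [m1 m2] : m < phi f /\ phi g < m by split; rewrite /m; lra.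
have /filter_ex[x []] : F [set x | m < f x /\ g x < m].
  apply: filterI; first exact: (cvgr_gt _ (Fcvg _ Sf)).
  exact: (cvgr_lt _ (Fcvg _ Sg)).
by move=> mf gm; have := fg x; rewrite leNgt (lt_trans gm mf).
Qed.

Lemma char_comp (f g : T -> R) (h : R -> R) : continuous h -> S f -> S g ->
  (forall x, g x = h (f x)) -> phi g = h (phi f).
Proof.
move=> hc Sf Sg gh; have [F [FF Fcvg]] := char_cvg.
apply: (@cvg_unique _ (@Rhausdorff R) (g @ F)); first exact: Fcvg.
rewrite (_ : g = h \o f); last exact/funext.
by apply: continuous_cvg; [exact: hc|exact: Fcvg].
Qed.

Lemma char_max (f g h : T -> R) : S f -> S g -> S h ->
  (forall x, h x = Num.max (f x) (g x)) -> phi h = Num.max (phi f) (phi g).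
Proof.
move=> Sf Sg Sh hE; have [F [FF Fcvg]] := char_cvg.
apply: (@cvg_unique _ (@Rhausdorff R) (h @ F)); first exact: Fcvg.
rewrite (_ : h = fun x => (f x + g x + `|f x - g x|) / 2); last first.
  by apply/funext => x; rewrite hE maxr_absE.
rewrite maxr_absE; apply: cvgMl; apply: cvgD.
  by apply: cvgD; exact: Fcvg.
by apply: cvg_norm; apply: cvgB; exact: Fcvg.
Qed.

Lemma char_min (f g h : T -> R) : S f -> S g -> S h ->
  (forall x, h x = Num.min (f x) (g x)) -> phi h = Num.min (phi f) (phi g).
Proof.
move=> Sf Sg Sh hE; have [F [FF Fcvg]] := char_cvg.
apply: (@cvg_unique _ (@Rhausdorff R) (h @ F)); first exact: Fcvg.
rewrite (_ : h = fun x => (f x + g x - `|f x - g x|) / 2); last first.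
  by apply/funext => x; rewrite hE minr_absE.
rewrite minr_absE; apply: cvgMl; apply: cvgB.
  by apply: cvgD; exact: Fcvg.
by apply: cvg_norm; apply: cvgB; exact: Fcvg.
Qed.

Lemma char_near0 (f g : T -> R) (r : R) : S f -> S g -> phi f < r ->
  (forall x, f x < r -> g x = 0) -> phi g = 0.
Proof.
move=> Sf Sg fr g0; have [F [FF Fcvg]] := char_cvg.
apply: (@cvg_unique _ (@Rhausdorff R) (g @ F)); first exact: Fcvg.
apply: cvg_near_cst.
have : \forall x \near F, f x < r.
  exact: (cvgr_lt _ (Fcvg _ Sf)).
by apply: filterS.
Qed.

End Characters.

(** * The two function algebras, and truncated quotients by the distance *)

Section MetricAlgebras.
Context {R : realType} {M : metricType R}.
Implicit Types (u k h : M -> R) (x y : M).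

Local Notation d := (@mdist R M).
Local Notation Mtil := (set_type (@Mtil_set R M)).

Definition lip1 u := forall x y, `|u x - u y| <= d x y.

Lemma UCb_alg : inv_closed_alg (@UCb R M).
Proof.
split.
- move=> c; split; first by exists `|c|.
  by move=> e e0; exists 1 => // x y _; rewrite subrr normr0.
- move=> f g [[A fA] fu] [[B gB] gu]; split.
    by exists (A + B) => x; rewrite (le_trans (ler_normD _ _))// lerD.
  move=> e e0; have e20 : 0 < e / 2 by rewrite divr_gt0.
  have [a a0 fa] := fu _ e20; have [b b0 gb] := gu _ e20.
  exists (Num.min a b); first by rewrite lt_min a0.
  move=> x y; rewrite lt_min => /andP[/fa fxy /gb gxy].
  rewrite [e]splitr opprD addrACA (le_lt_trans (ler_normD _ _))//.
  exact: ltrD.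
- move=> f g [[A fA] fu] [[B gB] gu]; split.
    by exists (A * B) => x; rewrite normrM ler_pM.
  move=> e e0; pose C := 1 + `|A| + `|B|.
  have C0 : 0 < C by rewrite /C -addrA ltr_pwDl// addr_ge0.
  have e20 : 0 < e / 2 / C by rewrite !divr_gt0.
  have [a a0 fa] := fu _ e20; have [b b0 gb] := gu _ e20.
  exists (Num.min a b); first by rewrite lt_min a0.
  move=> x y; rewrite lt_min => /andP[/fa fxy /gb gxy].
  have -> : f x * g x - f y * g y = (f x - f y) * g x + f y * (g x - g y).
    by ring.
  rewrite [e]splitr (le_lt_trans (ler_normD _ _))// !normrM ltrD//.
    rewrite -(mulfVK (lt0r_neq0 C0) (e / 2)).
    apply: le_lt_trans (_ : `|f x - f y| * C < _); last by rewrite ltr_pM2r.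
    rewrite ler_wpM2l//; apply: le_trans (gB x) _; apply: le_trans (ler_norm _) _.
    by rewrite /C lerDr addr_ge0.
  rewrite -(mulfVK (lt0r_neq0 C0) (e / 2)) mulrC.
  apply: le_lt_trans (_ : `|g x - g y| * C < _); last by rewrite ltr_pM2r.
  rewrite ler_wpM2l//; apply: le_trans (fA y) _; apply: le_trans (ler_norm _) _.
  by rewrite /C addrAC lerDr addr_ge0.
- move=> f e e0 [[A fA] fu] fe; have f0 x : 0 < f x by exact: lt_le_trans (fe x).
  have fV x : (f x)^-1 <= e^-1 by rewrite lef_pV2// posrE.
  split; first by exists e^-1 => x; rewrite ger0_norm// invr_ge0 ltW.
  (* Inversion is Lipschitz with constant [e^-1 * e^-1] on values at least [e], hence the modulus of
     [f] at [a * e * e]. *)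
  move=> a a0; have ae0 : 0 < a * e * e by rewrite !mulr_gt0.
  have [b b0 fb] := fu _ ae0; exists b => // x y /fb fxy.
  have -> : (f x)^-1 - (f y)^-1 = (f y - f x) * ((f x)^-1 * (f y)^-1).
    by field; rewrite !gt_eqF.
  rewrite normrM distrC [X in _ * X]ger0_norm; last first.
    by rewrite mulr_ge0// invr_ge0 ltW.
  apply: le_lt_trans (_ : `|f x - f y| * (e^-1 * e^-1) < _).
    by rewrite ler_wpM2l// ler_pM// invr_ge0 ltW.
  by rewrite -invfM ltr_pdivrMr ?mulr_gt0// mulrA.
Qed.

Lemma Cb_alg : inv_closed_alg (@Cb R M).
Proof.
split.
- move=> c; split; first exact: cst_continuous.
  by exists `|c|.
- move=> f g [fc [A fA]] [gc [B gB]]; split.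
    move=> x; apply: (@cvgD R R^o) (fc x) (gc x).
  by exists (A + B) => x; rewrite (le_trans (ler_normD _ _))// lerD.
- move=> f g [fc [A fA]] [gc [B gB]]; split.
    move=> x; apply: (@cvgM R _ (nbhs x) _ f g) (fc x) (gc x).
  by exists (A * B) => x; rewrite normrM ler_pM.
- move=> f e e0 [fc [A fA]] fe; have f0 z : 0 < f z by exact: lt_le_trans (fe z).
  split.
    by move=> z; apply: (@cvgV R _ (nbhs z) _ f) (fc z); rewrite gt_eqF.
  exists e^-1 => z; rewrite ger0_norm; last by rewrite invr_ge0 ltW.
  by rewrite lef_pV2// posrE.
Qed.

Lemma UCb_continuous h : UCb h -> continuous (h : M -> R^o).
Proof.
move=> [_ hu] x; apply/cvgrPdist_lt => e /hu[a a0 ha].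
apply/metricType_numDomainType.nbhs_mdistP; exists a => //= y xy.
exact: ha.
Qed.

Lemma lip1_continuous u : lip1 u -> continuous (u : M -> R^o).
Proof.
move=> ul x; apply/cvgrPdist_lt => e e0.
apply/metricType_numDomainType.nbhs_mdistP; exists e => //= y xy.
exact: le_lt_trans (ul _ _) xy.
Qed.

Lemma UCb_lip1 u (C : R) : lip1 u -> (forall x, 0 <= u x <= C) -> UCb u.
Proof.
move=> ul u01; split.
  by exists C => x; have /andP[? ?] := u01 x; rewrite ger0_norm.
by move=> e e0; exists e => // x y; exact: le_lt_trans.
Qed.

Lemma coord_continuous i : continuous (fun z : Mtil => Defs.coord i (set_val z)).
Proof.
have vc : continuous (set_val : Mtil -> M * M) by exact: initial_continuous.
move=> z; rewrite /Defs.coord; case: (i == 1%N).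
  exact: (@continuous_comp _ _ _ set_val fst z (vc z) cvg_fst).
exact: (@continuous_comp _ _ _ set_val snd z (vc z) cvg_snd).
Qed.

Lemma Cb_coord i h : UCb h -> Cb (fun z : Mtil => h (Defs.coord i (set_val z))).
Proof.
move=> hu; split; last by have [[C hC] _] := hu; exists C.
move=> z; apply: (@continuous_comp _ _ _ _ h z).
  exact: coord_continuous.
exact: UCb_continuous.
Qed.

Lemma mdist_lip (x y x' y' : M) : `|d x y - d x' y'| <= d x x' + d y y'.
Proof.
have h1 := metric_triangle x x' y; have h2 := metric_triangle x' y' y.
have h3 := metric_triangle x' x y'; have h4 := metric_triangle x y y'.
have s1 := metric_sym x x'; have s2 := metric_sym y y'.
by rewrite ler_norml; apply/andP; split; lra.
Qed.

Lemma mdist_continuous :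
  continuous (fun z : Mtil => d (set_val z).1 (set_val z).2 : R^o).
Proof.
move=> z; apply/(@cvgrPdist_lt _ R^o _ (nbhs z) (nbhs_filter z)) => e e0; have e20 : 0 < e / 2 by rewrite divr_gt0.
have c1 := @coord_continuous 1%N z.
have c2 := @coord_continuous 2%N z.
have n1 := metricType_numDomainType.cvgr_dist_lt (FF := nbhs_filter z) c1 e20.
have n2 := metricType_numDomainType.cvgr_dist_lt (FF := nbhs_filter z) c2 e20.
near=> w; rewrite [e]splitr; apply: le_lt_trans (mdist_lip _ _ _ _) _.
by apply: ltrD; [near: w; exact: n1|near: w; exact: n2].
Unshelve. all: by end_near. Qed.

Lemma Mtil_dist_gt0 (z : Mtil) : 0 < d (set_val z).1 (set_val z).2.
Proof.
by rewrite mdist_gt0; apply/eqP; have := set_valP z.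
Qed.

(** The cap at 1 keeps the quotient bounded where the distance tends to 0, so that it extends to the
    compactification. *)
Definition quot i k (z : Mtil) : R :=
  Num.min 1 (k (Defs.coord i (set_val z)) / d (set_val z).1 (set_val z).2).

Lemma quot_ge0 i k z : (forall x, 0 <= k x) -> 0 <= quot i k z.
Proof.
by move=> k0; rewrite le_min ler01 divr_ge0// ltW// Mtil_dist_gt0.
Qed.

Lemma quot_le1 i k z : quot i k z <= 1.
Proof. by rewrite ge_min lexx. Qed.

Lemma Cb_quot i k : (forall x, 0 <= k x) -> lip1 k -> Cb (quot i k).
Proof.
move=> k0 kl; split; last first.
  by exists 1 => z; rewrite ger0_norm ?quot_le1// quot_ge0.
move=> z; pose g (z : Mtil) := k (Defs.coord i (set_val z)).
pose D (z : Mtil) := d (set_val z).1 (set_val z).2.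
apply: (@continuous_min R _ (fun=> 1) (g \* (fun z => (D z)^-1)) z).
  exact: cst_continuous.
apply: (@cvgM R _ (nbhs z) _ g (fun z => (D z)^-1)).
  apply: (@continuous_comp _ _ _ _ k z).
    exact: coord_continuous.
  exact: lip1_continuous.
apply: (@cvgV R _ (nbhs z) _ D); first by rewrite gt_eqF// Mtil_dist_gt0.
exact: mdist_continuous.
Qed.

End MetricAlgebras.

(** * Pointwise topology, the two spectra, the projections and the finite part [RM] *)

Section Pointwise.
Context {I : Type} {V : topologicalType}.

Lemma ptws_eval_continuous (i : I) : continuous (fun f : {ptws I -> V} => f i).
Proof.
move=> f A Ai; have /cvg_sup/(_ i) : nbhs f --> f by exact: cvg_id.
apply; exact: (@initial_continuous _ _ (fun f : forall i : I, V => f i) f A Ai).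
Qed.

Lemma ptws_cvg (F : set_system {ptws I -> V}) (FF : Filter F) (f : {ptws I -> V}) :
  (forall i, (fun g : {ptws I -> V} => g i) @ F --> f i) -> F --> f.
Proof.
move=> Ff; apply/cvg_sup => i A [B [[C oC <-] Cf] /filterS]; apply.
by apply: Ff; exact: open_nbhs_nbhs.
Qed.

End Pointwise.

Section Spectra.
Context {R : realType} {M : metricType R}.
Implicit Types (u k h : M -> R) (x y : M).

Local Notation d := (@mdist R M).
Local Notation Mtil := (set_type (@Mtil_set R M)).
Local Notation betaM := (set_type (@betaM_set R M)).
Local Notation Mu := (set_type (@Mu_set R M)).

Definition bev (a : betaM) : (Mtil -> R) -> R := set_val a.
Definition mev (xi : Mu) : (M -> R) -> R := set_val xi.

Lemma bev_char a : is_char Cb (bev a).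
Proof. exact: (set_valP a). Qed.

Lemma mev_char xi : is_char UCb (mev xi).
Proof. exact: (set_valP xi). Qed.

Lemma bev_continuous f : continuous (fun a => bev a f : R^o).
Proof.
move=> a.
have vc : continuous (set_val : betaM -> {ptws (Mtil -> R) -> R^o}).
  exact: initial_continuous.
apply: (@continuous_comp _ {ptws (Mtil -> R) -> R^o} R^o set_val (fun g => g f) a).
  exact: vc.
exact: (@ptws_eval_continuous (Mtil -> R) R^o).
Qed.

Lemma mev_continuous h : continuous (fun xi => mev xi h : R^o).
Proof.
move=> xi.
have vc : continuous (set_val : Mu -> {ptws (M -> R) -> R^o}).
  exact: initial_continuous.
apply: (@continuous_comp _ {ptws (M -> R) -> R^o} R^o set_val (fun g => g h) xi).
  exact: vc.
exact: (@ptws_eval_continuous (M -> R) R^o).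
Qed.

Lemma cvg_Mu {T : Type} (F : set_system T) (FF : Filter F) (g : T -> Mu) xi :
  (forall h, UCb h -> (fun t => mev (g t) h) @ F --> (mev xi h : R^o)) ->
  g @ F --> xi.
Proof.
move=> gh.
have : (set_val \o g : T -> {ptws (M -> R) -> R^o}) @ F --> set_val xi.
  apply: ptws_cvg => h.
  (* Outside the algebra every character is 0 by normalisation, so only values on [UCb] matter. *)
  have [hu|hu] := pselect (UCb h); first exact: gh.
  have e0 zeta : mev zeta h = 0 by have [_ _ _ _ ->] := mev_char zeta.
  suff : (fun t => mev (g t) h) @ F --> (mev xi h : R^o) by [].
  by rewrite e0; apply: cvg_near_cst; apply: nearW => t; exact: e0.
move=> cv A [B [[C oC <-] Cxi] /filterS]; apply.
by apply: cv; exact: open_nbhs_nbhs.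
Qed.

Lemma betaM_hausdorff : hausdorff_space betaM.
Proof.
move=> a b ab; apply: val_inj; apply/funext => f.
apply: (@Rhausdorff R) => A B nA nB.
have [c [Ac Bc]] := ab _ _ (@bev_continuous f a A nA) (@bev_continuous f b B nB).
by exists (bev c f).
Qed.

(** For the first coordinate the claim becomes min(d(x,y), k(x)) <= min(d(x,u), k(x)) + min(d(u,y),
    k(u)), and symmetrically for the second. Each case follows from the triangle inequality,
    [k >= 0] or k(x) <= k(u) + d(x,u). *)
Lemma quot_Gset i k : (forall x, 0 <= k x) -> lip1 k ->
  Gset (fun a => bev a (quot i k)).
Proof.
move=> k0 kl; split; first exact: bev_continuous.
move=> x u y a b c /eqP xu /eqP uy /eqP xy ea eb ec.
have Q := Cb_quot i k0 kl.
have ev x1 x2 (x12 : x1 != x2) e : is_ev_beta e x1 x2 ->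
    d x1 x2 * bev e (quot i k) =
    Num.min (d x1 x2) (k (if i == 1%N then x1 else x2)).
  move=> ee.
  have x12' : (x1, x2) \in @Mtil_set R M by apply/mem_set => /= /eqP; apply/negP.
  have d0 : 0 < d x1 x2 by rewrite mdist_gt0.
  rewrite [bev e _](ee (exist (fun z => z \in @Mtil_set R M) (x1, x2) x12') erefl _ Q) /quot /Defs.coord /=.
  by rewrite minr_pMr ?(ltW d0)// mulr1 mulrC divfK// gt_eqF.
rewrite !ev//.
have tri := metric_triangle x u y.
have [xu0 uy0 xy0] : [/\ 0 <= d x u, 0 <= d u y & 0 <= d x y] by rewrite !mdist_ge0.
have := k0 x; have := k0 u; have := k0 y.
have := kl x u; have := kl y u; rewrite (metric_sym y u) !ler_norml.
move=> /andP[? ?] /andP[? ?] ? ? ?.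
by case: (i == 1%N); rewrite /Num.min; do !case: ltP => ?; lra.
Qed.

(** Composition with a coordinate maps [UCb] into [Cb] and respects the operations, so the character
    [a] pulls back; the value 0 off [UCb] is the normalisation in [is_char]. *)
Lemma proj_graph_ex i a : exists xi : Mu, proj_graph i a xi.
Proof.
pose phi : (M -> R) -> R := fun h =>
  if `[< UCb h >] then bev a (fun z => h (Defs.coord i (set_val z))) else 0.
have phiE h : UCb h -> phi h = bev a (fun z => h (Defs.coord i (set_val z))).
  by move=> hu; rewrite /phi; case: asboolP.
have [p1 pD pZ pM _] := bev_char a.
have alg := @UCb_alg R M.
have phiP : Mu_set phi.
  split.
  - by rewrite phiE ?p1//; exact: (ica_cst alg).
  - move=> f g fu gu; rewrite !phiE// ?pD//; try exact: Cb_coord.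
    exact: (ica_add alg).
  - move=> c f fu; rewrite !phiE// ?pZ//; first exact: Cb_coord.
    exact: (ica_mul alg (ica_cst alg c) fu).
  - move=> f g fu gu; rewrite !phiE// ?pM//; try exact: Cb_coord.
    exact: (ica_mul alg).
  - by move=> f fu; rewrite /phi; case: asboolP.
by exists (exist (fun p => p \in @Mu_set R M) phi (mem_set phiP)) => h /phiE.
Qed.

Definition proj_ext i a : Mu := sval (cid (proj_graph_ex i a)).

Lemma proj_extE i a h : UCb h ->
  mev (proj_ext i a) h = bev a (fun z => h (Defs.coord i (set_val z))).
Proof. by rewrite /proj_ext; case: cid => xi /= axi /axi. Qed.

Lemma proj_graphP i a xi : proj_graph i a xi <-> xi = proj_ext i a.
Proof.
split=> [axi|->]; last by move=> h /proj_extE.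
apply: val_inj; apply/funext => h.
have [hu|hu] := pselect (UCb h); first by rewrite -[RHS]/(mev _ _) proj_extE//; exact: axi.
have [_ _ _ _ xi0] := mev_char xi; have [_ _ _ _ p0] := mev_char (proj_ext i a).
by rewrite -[LHS]/(mev _ _) -[RHS]/(mev _ _) xi0// p0.
Qed.

Lemma proj_ext_continuous i : continuous (proj_ext i).
Proof.
move=> a; apply: (cvg_Mu (nbhs_filter a)) => h hu; rewrite proj_extE//.
rewrite (_ : (fun t => _) = (fun t => bev t (fun z => h (Defs.coord i (set_val z))))).
  exact: bev_continuous.
by apply/funext => b; rewrite proj_extE.
Qed.

Lemma preim_pE i E : preim_p i E = proj_ext i @^-1` E.
Proof.
apply/seteqP; split=> a.
  by move=> [xi /proj_graphP -> ?].
by move=> Ea; exists (proj_ext i a) => //; exact/proj_graphP.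
Qed.

Lemma evM_subproof x : Mu_set (fun h => if `[< UCb h >] then h x else 0).
Proof.
have alg := @UCb_alg R M.
pose phi h := if `[< UCb h >] then h x else 0.
have phiE h : UCb h -> phi h = h x by rewrite /phi; case: asboolP.
rewrite -/phi; split.
- by rewrite phiE//; exact: (ica_cst alg).
- by move=> f g fu gu; rewrite !phiE//; exact: (ica_add alg fu gu).
- move=> c f fu; rewrite !phiE//.
  exact: (ica_mul alg (ica_cst alg c) fu).
- by move=> f g fu gu; rewrite !phiE//; exact: (ica_mul alg fu gu).
- by move=> f fu; rewrite /phi; case: asboolP.
Qed.

Definition evM x : Mu := 
  exist (fun p => p \in @Mu_set R M) _ (mem_set (evM_subproof x)).

Lemma evME x h : UCb h -> mev (evM x) h = h x.
Proof.
move=> hu; have -> : mev (evM x) h = if `[< UCb h >] then h x else 0 by [].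
by case: asboolP.
Qed.

Section Based.
Variable x0 : M.

(** A bounded Lipschitz substitute for the distance to the base point: its extension to [Mu] is
    positive exactly on [RM]. *)
Definition decay x : R := (1 + d x x0)^-1.

Lemma decay_gt0 x : 0 < decay x.
Proof. by rewrite invr_gt0 ltr_pwDl// mdist_ge0. Qed.

Lemma decay_le1 x : decay x <= 1.
Proof. by rewrite invf_le1 ?lerDl ?mdist_ge0// ltr_pwDl// mdist_ge0. Qed.

Lemma decay_lip1 : lip1 decay.
Proof.
move=> x y; have x1 := mdist_ge0 x x0; have y1 := mdist_ge0 y x0.
have -> : decay x - decay y = (d y x0 - d x x0) * (decay x * decay y).
  by rewrite /decay; field; rewrite !lt0r_neq0// ltr_pwDl.
rewrite normrM [X in _ * X]ger0_norm; last by rewrite mulr_ge0// ltW// decay_gt0.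
have dd : `|d y x0 - d x x0| <= d x y.
  by have := mdist_lip y x0 x x0; rewrite mdistxx addr0 (metric_sym y x).
apply: le_trans dd; rewrite -[leRHS]mulr1 ler_wpM2l// mulr_ile1 ?decay_le1//.
all: by rewrite ltW// decay_gt0.
Qed.

Lemma UCb_decay : UCb decay.
Proof.
apply: (UCb_lip1 (C := 1)); first exact: decay_lip1.
by move=> x; rewrite decay_le1 ltW// decay_gt0.
Qed.

(** The function inside [dbar0] is 1 - [decay], so the test [s < 1] there says that the value on
    [decay] is positive. *)
Lemma RMP xi : RM x0 xi <-> 0 < mev xi decay.
Proof.
have alg := @UCb_alg R M.
have [_ pD pZ _ _] := mev_char xi.
rewrite /RM /= /dbar0 -/(mev xi).
rewrite (_ : mev xi _ = 1 - mev xi decay).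
  rewrite ltrBlDr ltrDl; case: ifP => // _; split => // _.
  exact: ltry.
rewrite -[X in X - _](char_cst alg (mev_char xi)) -[- _]mulN1r -pZ; last exact: UCb_decay.
rewrite -pD; first last.
- apply: (ica_mul alg); first exact: (ica_cst alg).
  exact: UCb_decay.
- exact: (ica_cst alg).
congr mev; apply/funext => x; rewrite /decay.
by field; rewrite lt0r_neq0// ltr_pwDl// mdist_ge0.
Qed.

Lemma RM_evM x : RM x0 (evM x).
Proof. by apply/RMP; rewrite evME ?decay_gt0//; exact: UCb_decay. Qed.

Lemma RM_open : open (RM x0).
Proof.
rewrite (_ : RM x0 = (fun xi => mev xi decay) @^-1` [set r : R^o | 0 < r]).
  by apply: open_comp; [move=> ? _; exact: mev_continuous|exact: open_gt].
by apply/seteqP; split => xi /RMP.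
Qed.

Lemma RcalP a : Rcal x0 a <->
  0 < mev (proj_ext 1 a) decay /\ 0 < mev (proj_ext 2 a) decay.
Proof.
split=> [[xi1 [xi2 [/proj_graphP -> /proj_graphP -> /RMP ? /RMP ?]]]//|].
move=> [/RMP ? /RMP ?]; exists (proj_ext 1 a), (proj_ext 2 a).
by split => //; exact/proj_graphP.
Qed.

(** The point [xi] is a limit of points [evM x], all in [RM], where [F] agrees with [f]; continuity
    of [F] within [RM] then gives the limit of [f]. The outer [H] is there because [f] may be
    unbounded, hence outside [UCb]. *)
Lemma RM_extension (F : Mu -> R) f (H : R -> R) xi :
  {within RM x0, continuous (F : Mu -> R^o)} ->
  (forall a x, RM x0 a -> is_ev_Mu a x -> F a = f x) ->
  continuous H -> UCb (H \o f) -> RM x0 xi ->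
  mev xi (H \o f) = H (F xi).
Proof.
move=> Fc Ff Hc Hf xiR.
have [G [GG Gcvg]] := char_cvg (@UCb_alg R M) (mev_char xi).
apply: (@cvg_unique _ (@Rhausdorff R) ((H \o f) @ G)); first exact: Gcvg.
have evc : evM @ G --> xi.
  apply: cvg_Mu => h hu; rewrite (_ : (fun t => _) = h); first exact: Gcvg.
  by apply/funext => x; rewrite evME.
have evw : evM @ G --> within (RM x0) (nbhs xi).
  move=> A /evc; apply: (@filterS _ G) => x /=; apply; exact: RM_evM.
have fF : f = F \o evM.
  apply/funext => x /=; apply/esym/Ff; first exact: RM_evM.
  by move=> h hu; exact: evME.
have Fw := (subspace_continuousP _ _).1 Fc _ xiR.
have fcv : f @ G --> (F xi : R^o).
  by rewrite fF; exact: cvg_comp evw Fw.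
exact: (@cvg_comp _ _ _ f H G _ _ fcv (Hc (F xi))).
Qed.

Lemma dbar_separation xi eta (e : R) : 0 < e -> RM x0 xi -> RM x0 eta ->
  (e%:E <= dbar x0 xi eta)%E ->
  exists u, [/\ lip1 u, forall x, 0 <= u x <= 1,
    mev eta u = 0 & Num.min 1 (e / 2) <= mev xi u].
Proof.
move=> e0 xiR etaR exe.
(* Halving [e] makes the inequality strict, so some competitor [F] in the supremum exceeds
   [e / 2]. *)
have : ((e / 2)%:E < dbar x0 xi eta)%E.
  by apply: lt_le_trans exe; rewrite lte_fin; lra.
case/ereal_sup_gt => _ [F [f [[f0 fl] [Fc Ff]]] <-]; rewrite lte_fin => eF.
(* Distance to [F eta], cut at 1: composed with [f] it stays 1-Lipschitz, becomes bounded and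
   vanishes at [eta]. *)
pose H (r : R) := Num.min 1 `|r - F eta|.
have Hc : continuous (H : R^o -> R^o).
  move=> r; apply: (@continuous_min R R^o (fun=> 1) (fun r => `|r - F eta|)).
    exact: cst_continuous.
  by apply: cvg_norm; apply: cvgB; [exact: cvg_id|exact: cvg_cst].
have ul : lip1 (H \o f).
  move=> x y; apply: le_trans (fl x y); rewrite /H /=.
  have := ler_dist_dist (f x - F eta) (f y - F eta).
  rewrite opprB addrA subrK.
  move: `|f x - F eta| `|f y - F eta| `|f x - f y| => p q r.
  rewrite !ler_norml => /andP[? ?].
  by rewrite /Num.min; do !case: ltP => ?; apply/andP; split; lra.
have u01 x : 0 <= (H \o f) x <= 1 by rewrite le_min ler01 normr_ge0 ge_min lexx.
have Hf := UCb_lip1 ul u01.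
exists (H \o f); split => //.
  by rewrite (RM_extension Fc Ff Hc Hf etaR) /H subrr normr0 min_r.
rewrite (RM_extension Fc Ff Hc Hf xiR) /H le_min ge_min lexx /=.
by rewrite ge_min (ltW eF) orbT.
Qed.

End Based.
End Spectra.

(** * Compactness for directed open covers *)

(** Upper tails of the index family form a proper filter, and the near-covering form of compactness
    makes one index work for all of [K]. Later the indices are functions, directed by minima or
    maxima. *)
Lemma compact_directed_cover {T : topologicalType} {I : Type} (K : set T)
    (D : set I) (U : I -> set T) :
  compact K -> D !=set0 -> (forall i, D i -> open (U i)) ->
  (forall i j, D i -> D j -> exists k, [/\ D k, U i `<=` U k & U j `<=` U k]) ->
  (forall x, K x -> exists2 i, D i & U i x) -> exists2 i, D i & K `<=` U i.
Proof.
move=> /compact_near_coveringP Kc [i0 Di0] Uo dir cov.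
pose B i := [set j | D j /\ U i `<=` U j].
have FF : ProperFilter (filter_from D B).
  apply: filter_from_proper; last by move=> i Di; exists i; split.
  apply: filter_from_filter; first by exists i0.
  move=> i j Di Dj; have [k [Dk ik jk]] := dir _ _ Di Dj; exists k => //.
  by move=> l [Dl kl]; split; split => //; exact: subset_trans kl.
have : \forall i \near filter_from D B, K `<=` U i.
  apply: Kc => x /cov[i Di Uix].
  exists (U i, B i) => /=.
    split; first by apply: open_nbhs_nbhs; split => //; exact: Uo.
    by exists i.
  by move=> [y j] /= [Uiy [_ ij]]; exact: ij.
have : \forall i \near filter_from D B, D i.
  by exists i0 => // i [].
move=> F1 F2; have [i [Di Ki]] := filter_ex (filterI F1 F2).
by exists i.
Qed.

(** * Borel sets of the compactification and a criterion for null sets *)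

Section BorelBeta.
Context {R : realType} {M : metricType R}.
Local Notation betaM := (set_type (@betaM_set R M)).
Local Notation Mu := (set_type (@Mu_set R M)).
Local Notation betaB pt := (g_sigma_algebraType (T := betaP pt) (@open betaM)).
Variable pt : betaM.

Lemma open_measurable_beta (A : set (betaB pt)) : @open betaM A -> measurable A.
Proof. exact: sub_sigma_algebra. Qed.

Lemma compact_measurable_beta (A : set (betaB pt)) :
  @compact betaM A -> measurable A.
Proof.
move=> /(compact_closed (@betaM_hausdorff R M)) cA.
rewrite -[A]setCK; apply: measurableC; apply: open_measurable_beta.
exact: closed_openC.
Qed.

Lemma continuous_measurable_beta (g : betaM -> R) :
  continuous (g : betaM -> R^o) ->
  measurable_fun [set: betaB pt] (g : betaB pt -> R).
Proof.
move=> gc; apply: (measurability _ (measurable_realfun.RGenOpens.measurableE R)).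
move=> _ [_ [a [b ->] <-]]; rewrite setTI.
apply: open_measurable_beta; apply: open_comp; last exact: interval_open.
by move=> x _; exact: gc.
Qed.

(** Sets with measurable preimage are closed under complement in [RM] and countable union, and
    include the traces of open sets. *)
Lemma preim_measurable x0 i (E : set Mu) : Borel_in_RM x0 E ->
  measurable (preim_p i E : set (betaB pt)).
Proof.
move=> [_ EB]; rewrite preim_pE.
have RMm : measurable (proj_ext i @^-1` RM x0 : set (betaB pt)).
  apply: open_measurable_beta; apply: open_comp; last exact: RM_open.
  by move=> x _; exact: proj_ext_continuous.
pose G := [set A : set Mu | measurable (proj_ext i @^-1` A : set (betaB pt))].
apply: (@smallest_sub _ (sigma_algebra (RM x0)) _ G) EB.
  split.
  - by rewrite /G /= preimage_set0; exact: measurable0.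
  - by move=> A GA; rewrite /G /= setDE preimage_setI preimage_setC -setDE; exact: measurableD.
  - move=> A GA; rewrite /G /= preimage_bigcup; apply: bigcup_measurable => k _; exact: GA.
move=> _ [U oU <-]; rewrite /G /= preimage_setI; apply: measurableI => //.
apply: open_measurable_beta; apply: open_comp => //.
by move=> x _; exact: proj_ext_continuous.
Qed.

Variables mu nu : {measure set betaB pt -> \bar R}.

(** For every n, c mu(A) <= int g dmu <= int g dnu <= 2 nu(complement of K_n) <= 2/(n+1). The upper
    bound 2 on [g] leaves room for a sum of two quotients. *)
Lemma prec_null (K : nat -> set betaM) (A : set (betaB pt)) (c : R) :
  prec mu nu -> (forall n, compact (K n)) ->
  (forall n, (nu (~` K n) <= n.+1%:R^-1%:E)%E) ->
  measurable A -> 0 < c ->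
  (forall n, exists g, [/\ Gset g, forall a, 0 <= g a <= 2,
     forall a, K n a -> g a = 0 & forall a, A a -> c <= g a]) ->
  mu A = 0%E.
Proof.
move=> mn Kc nuK mA c0 gn.
have bound n : (c%:E * mu A <= (2 * n.+1%:R^-1)%:E)%E.
  have [g [Gg g02 gK gA]] := gn n.
  have mg := continuous_measurable_beta Gg.1.
  have mgE : measurable_fun [set: betaB pt] (EFin \o (g : betaB pt -> R)).
    exact/measurable_EFinP.
  have mK : measurable (~` K n : set (betaB pt)).
    by apply: measurableC; exact: compact_measurable_beta.
  have indic_bound (m : {measure set betaB pt -> \bar R}) (B : set (betaB pt)) (r : R) :
      measurable B -> 0 <= r -> (\int[m]_a (r * \1_B a)%:E = r%:E * m B)%E.
    move=> mB r0; under eq_integral do rewrite EFinM.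
    rewrite ge0_integralZl_EFin//.
    - by rewrite integral_indic// setIT.
    - by apply/measurable_EFinP; exact: measurable_indic.
  have mindic (B : set (betaB pt)) (r : R) : measurable B ->
      measurable_fun [set: betaB pt]
        (EFin \o (fun a : betaB pt => r * \1_B a)).
    move=> mB; apply/measurable_EFinP; apply: measurable_funM.
      exact: measurable_cst.
    exact: measurable_indic.
  apply: le_trans (_ : \int[mu]_a (g a)%:E <= _)%E.
    rewrite -(indic_bound _ _ _ mA (ltW c0)); apply: ge0_le_integral => //.
    - by move=> a _; rewrite lee_fin mulr_ge0 ?(ltW c0).
    - exact: mindic.
    move=> a _; rewrite lee_fin indicE; have [/set_mem/gA|_] := boolP (a \in A).
      by rewrite mulr1.
    by rewrite mulr0; have /andP[] := g02 a.
  apply: le_trans (mn _ Gg) _.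
  apply: le_trans (_ : \int[nu]_a (2 * \1_(~` K n) a)%:E <= _)%E.
    apply: ge0_le_integral => //.
    - by move=> a _; rewrite lee_fin; have /andP[] := g02 a.
    - exact: mindic.
    move=> a _; rewrite lee_fin indicE.
    have [_|] := boolP (a \in ~` K n); first by rewrite mulr1; have /andP[] := g02 a.
    by rewrite mulr0 notin_setE /= => /contrapT/gK ->.
  by rewrite indic_bound// EFinM lee_pmul2l.
apply/eqP; rewrite eq_le measure_ge0 andbT -(@lee_pmul2l _ c%:E)// mule0.
apply/lee_addgt0Pr => e e0; rewrite add0e.
have e20 : 0 < e / 2 by rewrite divr_gt0.
have [n en] := filter_ex (near_infty_natSinv_lt (PosNum e20)).
apply: le_trans (bound n) _; rewrite lee_fin.
have {}en : n.+1%:R^-1 < e / 2 := en.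
by move: (n.+1%:R^-1) en => t; lra.
Qed.

End BorelBeta.

(** * Values of the quotient test functions on the compactification *)

Section TestFunctions.
Context {R : realType} {M : metricType R}.
Implicit Types (u k h : M -> R) (x y : M).
Local Notation d := (@mdist R M).
Local Notation Mtil := (set_type (@Mtil_set R M)).
Local Notation betaM := (set_type (@betaM_set R M)).
Variables (x0 : M).

Lemma Gset_add (f g : betaM -> R) : Gset f -> Gset g ->
  Gset (fun a => f a + g a).
Proof.
move=> [fc fG] [gc gG]; split.
  by move=> a; apply: (@cvgD R R^o) (fc a) (gc a).
move=> x u y a b c xu uy xy ea eb ec; rewrite !mulrDr.
by rewrite addrACA lerD// ?fG// gG.
Qed.

Lemma quot_eq0 i k (z : Mtil) : k (Defs.coord i (set_val z)) = 0 -> quot i k z = 0.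
Proof. by move=> kz; rewrite /quot kz mul0r min_r. Qed.

Lemma bev_quot_ge0 i k a : (forall x, 0 <= k x) -> lip1 k ->
  0 <= bev a (quot i k) <= 1.
Proof.
move=> k0 kl; have alg := @Cb_alg R M; have ch := bev_char a.
have Q := Cb_quot i k0 kl.
rewrite -{1}(char_cst alg ch 0) -(char_cst alg ch 1); apply/andP; split.
  by apply: (char_le alg ch (ica_cst alg 0) Q) => z; exact: quot_ge0.
by apply: (char_le alg ch Q (ica_cst alg 1)) => z; exact: quot_le1.
Qed.

(* Where [u < r] the function [k] vanishes identically, so [quot i k] vanishes
   at boundary points even when the distance degenerates to 0 there. *)
Lemma bev_quot_eq0 i k u (r : R) a : (forall x, 0 <= k x) -> lip1 k -> UCb u ->
  (forall x, u x < r -> k x = 0) -> mev (proj_ext i a) u < r ->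
  bev a (quot i k) = 0.
Proof.
move=> k0 kl uu uk; rewrite proj_extE// => ur.
apply: (char_near0 (@Cb_alg R M) (bev_char a) (Cb_coord i uu) (Cb_quot i k0 kl) ur).
by move=> z /uk; exact: quot_eq0.
Qed.

(** A continuous lower bound for the reciprocal distance, positive on [Rcal]: d(x,y) <= d(x,0) +
    d(0,y) <= (1 + d(x,0)) (1 + d(y,0)). *)
Definition decay2 a : R :=
  mev (proj_ext 1 a) (decay x0) * mev (proj_ext 2 a) (decay x0).

Lemma decay2_gt0 a : Rcal x0 a -> 0 < decay2 a.
Proof. by move=> /RcalP[? ?]; rewrite mulr_gt0. Qed.

Lemma decay2_continuous : continuous (decay2 : betaM -> R^o).
Proof.
move=> a; apply: (@cvgM R _ (nbhs a) _ (fun a => mev (proj_ext 1 a) (decay x0))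
  (fun a => mev (proj_ext 2 a) (decay x0))).
all: apply: (@continuous_comp _ _ _ _ (fun xi => mev xi (decay x0)) a).
all: by [exact: proj_ext_continuous|exact: mev_continuous].
Qed.

(** Pointwise, [k] times the two decays is at most 1 and at most [k] over the distance; characters
    are monotone and multiplicative. *)
Lemma bev_quot_ge i k a : (forall x, 0 <= k x <= 1) -> lip1 k ->
  mev (proj_ext i a) k * decay2 a <= bev a (quot i k).
Proof.
move=> k01 kl; have k0 x : 0 <= k x by have /andP[] := k01 x.
have Q := Cb_quot i k0 kl; have [_ _ _ pM _] := bev_char a.
have C1 := Cb_coord 1 (UCb_decay x0); have C2 := Cb_coord 2 (UCb_decay x0).
have Ck := Cb_coord i (UCb_lip1 kl k01).
have uk := UCb_lip1 kl k01; have uq := UCb_decay x0.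
rewrite /decay2 !proj_extE//.
rewrite -pM// -pM//; last exact: (ica_mul (@Cb_alg R M) C1 C2).
apply: (char_le (@Cb_alg R M) (bev_char a)) => //.
  exact: (ica_mul (@Cb_alg R M) Ck (ica_mul (@Cb_alg R M) C1 C2)).
move=> z /=; rewrite /quot; have := k01 (Defs.coord i (set_val z)).
move: (k _) => t /andP[t0 t1]; rewrite /Defs.coord /=.
have D0 := Mtil_dist_gt0 z; move: (set_val z) D0 => [x y] /= D0.
have [p0 p1] := (decay_gt0 x0 x, decay_le1 x0 x).
have [q0 q1] := (decay_gt0 x0 y, decay_le1 x0 y).
have pq : decay x0 x * decay x0 y <= (d x y)^-1.
  have [x1 y1] : 0 < 1 + d x x0 /\ 0 < 1 + d y x0.
    by rewrite !ltr_pwDl ?mdist_ge0.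
  rewrite /decay -invfM lef_pV2 ?posrE ?mulr_gt0//.
  have := metric_triangle x x0 y; rewrite (metric_sym x0 y).
  have := mulr_ge0 (mdist_ge0 x x0) (mdist_ge0 y x0); nra.
rewrite le_min ler_wpM2l// andbT mulr_ile1 ?mulr_ge0 ?mulr_ile1//.
all: exact: ltW.
Qed.

(* As [N] grows, [quot i (far N)] eventually vanishes at each point of [Rcal],
   while [quot 1 (far N) + quot 2 (far N)] stays at least 1 off [Rcal]. *)
Definition far (N : R) x : R := Num.max 0 (d x x0 - N).

Lemma far_ge0 N x : 0 <= far N x.
Proof. by rewrite le_max lexx. Qed.

Lemma far_lip1 N : lip1 (far N).
Proof.
move=> x y; rewrite /far.
have := mdist_lip x x0 y x0; rewrite mdistxx addr0.
move: (d x x0) (d y x0) (d x y) => a b c.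
rewrite !ler_norml => /andP[? ?].
by rewrite /Num.max; do !case: ltP => ?; apply/andP; split; lra.
Qed.

Lemma far_eq0 (N : R) i a : 0 <= N ->
  (1 + N)^-1 < mev (proj_ext i a) (decay x0) -> bev a (quot i (far N)) = 0.
Proof.
move=> N0 Na; have [_ _ pZ _ _] := mev_char (proj_ext i a).
have alg := @UCb_alg R M.
(* [bev_quot_eq0] asks for an upper bound, hence [decay] with its sign changed: -decay(x) < -1/(1+N)
   means d(x,0) < N. *)
have Um := ica_mul alg (ica_cst alg (-1)) (UCb_decay x0).
apply: (bev_quot_eq0 (r := - (1 + N)^-1) (far_ge0 N) (@far_lip1 N) Um).
  move=> x; rewrite mulN1r ltrN2 /decay ltf_pV2 ?ltrD2l.
  - by move=> xN; rewrite /far max_l// subr_le0 ltW.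
  - by rewrite posrE ltr_pwDl.
  - by rewrite posrE ltr_pwDl// mdist_ge0.
by rewrite pZ ?mulN1r ?ltrN2//; exact: UCb_decay.
Qed.

(** Here [A], [B], [D] stand for d(x,0), d(y,0), d(x,y). If a cap at 1 is active the claim is
    immediate. Otherwise A < D + N, and the quotients sum to at least (A + B - 2N)/D >= 1 - 2N/D, so
    the loss is controlled by a multiple of 1/(1+A), which disappears at infinity. *)
Lemma far_bound (N A B D : R) : 0 <= N -> 0 <= A -> 0 <= B -> 0 < D ->
  D <= A + B -> A <= B + D -> B <= A + D ->
  1 <= Num.min 1 (Num.max 0 (A - N) / D) + Num.min 1 (Num.max 0 (B - N) / D)
       + (1 + 2 * N) * (1 + N) * (1 + A)^-1.
Proof.
move=> N0 A0 B0 D0 DAB ABD BAD.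
have [mA0 mB0] : 0 <= Num.max 0 (A - N) / D /\ 0 <= Num.max 0 (B - N) / D.
  by rewrite !divr_ge0 ?le_max ?lexx ?(ltW D0).
have t0 : 0 <= (1 + 2 * N) * (1 + N) * (1 + A)^-1.
  by rewrite mulr_ge0 ?invr_ge0 ?addr_ge0// mulr_ge0 ?addr_ge0 ?mulr_ge0.
have [A1|A1] := leP 1 (Num.max 0 (A - N) / D).
  rewrite -addrA lerDl addr_ge0// le_min ler01//.
have [B1|B1] := leP 1 (Num.max 0 (B - N) / D).
  by rewrite addrAC lerDr addr_ge0.
have AN : (A - N) / D <= Num.max 0 (A - N) / D.
  by rewrite ler_pM2r ?invr_gt0// le_max lexx orbT.
have BN : (B - N) / D <= Num.max 0 (B - N) / D.
  by rewrite ler_pM2r ?invr_gt0// le_max lexx orbT.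
have AND : A < D + N.
  by move: (le_lt_trans AN A1); rewrite ltr_pdivrMr// mul1r; lra.
have s : 1 - 2 * N / D <= Num.max 0 (A - N) / D + Num.max 0 (B - N) / D.
  apply: le_trans (lerD AN BN); rewrite -mulrDl.
  have -> : 1 - 2 * N / D = (D - 2 * N) / D by rewrite mulrBl divff// gt_eqF.
  by rewrite ler_pM2r ?invr_gt0//; lra.
have A10 : 0 < 1 + A by lra.
(* If D <= 2N then A < 3N, and (1 + 2N)(1 + N) = 1 + 3N + 2N^2 exceeds 1 + A. *)
have [DN|DN] := leP D (2 * N).
  suff : 1 <= (1 + 2 * N) * (1 + N) * (1 + A)^-1 by lra.
  by rewrite ler_pdivlMr// mul1r; nra.
suff : 2 * N / D <= (1 + 2 * N) * (1 + N) * (1 + A)^-1 by lra.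
rewrite ler_pdivrMr// mulrAC ler_pdivlMr//.
have := mulr_ge0 N0 N0; nra.
Qed.

Lemma far_ge1 (N : R) a : 0 <= N -> ~ Rcal x0 a ->
  1 <= bev a (quot 1 (far N)) + bev a (quot 2 (far N)).
Proof.
move=> N0 aR; have alg := @Cb_alg R M; have ch := bev_char a.
have [_ pD pZ _ _] := ch.
have Q1 := Cb_quot 1 (far_ge0 N) (@far_lip1 N).
have Q2 := Cb_quot 2 (far_ge0 N) (@far_lip1 N).
pose C := (1 + 2 * N) * (1 + N).
have key j : j = 1%N \/ j = 2%N -> mev (proj_ext j a) (decay x0) <= 0 ->
    1 <= bev a (quot 1 (far N)) + bev a (quot 2 (far N)).
  move=> jE j0; have Cj := Cb_coord j (UCb_decay x0).
  have CC := ica_mul alg (ica_cst alg C) Cj.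
  suff : 1 <= bev a (quot 1 (far N)) + bev a (quot 2 (far N)) +
      C * mev (proj_ext j a) (decay x0).
    by move/le_trans; apply; rewrite gerDl mulr_ge0_le0// mulr_ge0 ?addr_ge0 ?mulr_ge0.
  rewrite proj_extE; last exact: UCb_decay.
  rewrite -pZ// -pD// -pD//; last exact: (ica_add alg).
  rewrite -[leLHS](char_cst alg ch); apply: (char_le alg ch).
  - exact: (ica_cst alg).
  - exact: (ica_add alg (ica_add alg Q1 Q2) CC).
  move=> z; have D0 := Mtil_dist_gt0 z; rewrite /quot /far /Defs.coord /=.
  move: (set_val z) D0 => [x y] /= D0.
  have ? := metric_triangle x x0 y; have ? := metric_triangle x y x0.
  have ? := metric_triangle y x x0.
  have ? := metric_sym x0 y; have ? := metric_sym x y.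
  have [? ?] := (mdist_ge0 x x0, mdist_ge0 y x0).
  case: jE => -> /=; first by apply: far_bound => //; lra.
  by rewrite [X in X + _]addrC; apply: far_bound => //; lra.
have [p|] := ltP 0 (mev (proj_ext 1 a) (decay x0)); last by apply: key; left.
have [q|] := ltP 0 (mev (proj_ext 2 a) (decay x0)); last by apply: key; right.
by case: aR; apply/RcalP.
Qed.

(** The sets where both [decay] values exceed 1/(1+n) are open, increase with n and cover [Rcal], so
    one of them contains [K]. *)
Lemma far_compact (K : set betaM) : compact K -> K `<=` Rcal x0 ->
  exists2 N : R, 0 <= N & forall a, K a ->
    bev a (quot 1 (far N)) + bev a (quot 2 (far N)) = 0.
Proof.
move=> Kc KR.
pose U (n : nat) : set betaM :=
  [set a | (1 + n%:R)^-1 < mev (proj_ext 1 a) (decay x0)] `&`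
  [set a | (1 + n%:R)^-1 < mev (proj_ext 2 a) (decay x0)].
have Uo n : open (U n).
  have o i : open [set a | (1 + n%:R)^-1 < mev (proj_ext i a) (decay x0)].
    apply: (@open_comp _ R^o (fun a => mev (proj_ext i a) (decay x0)) [set r | _ < r]).
      move=> a _; apply: (@continuous_comp _ _ _ _ (fun xi => mev xi (decay x0)) a).
        exact: proj_ext_continuous.
      exact: mev_continuous.
    exact: open_gt.
  by apply: openI.
have Umono n m : (n <= m)%N -> U n `<=` U m.
  move=> nm a [a1 a2]; have nm' : (1 + m%:R)^-1 <= (1 + n%:R)^-1 :> R.
    by rewrite lef_pV2 ?lerD2l ?ler_nat// posrE ltr_pwDl.
  by split; exact: le_lt_trans nm' _.
have [|i j _ _|a /KR /RcalP[a1 a2]|n _ KU] :=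
    @compact_directed_cover _ _ K setT U Kc _ (fun n _ => Uo n).
- by exists 0%N.
- exists (maxn i j); split => //; apply: Umono; first exact: leq_maxl.
  exact: leq_maxr.
- have ex (t : R) : 0 < t -> exists n, forall m, (n <= m)%N -> (1 + m%:R)^-1 < t.
    move=> t0; have [n _ nt] := near_infty_natSinv_lt (PosNum t0).
    by exists n => m /nt; rewrite -natr1 addrC.
  have [n1 h1] := ex _ a1; have [n2 h2] := ex _ a2.
  exists (maxn n1 n2) => //; split; [apply: h1|apply: h2].
    exact: leq_maxl.
  exact: leq_maxr.
- exists n%:R => // a /KU[a1 a2]; rewrite !far_eq0 ?addr0//.
Qed.

End TestFunctions.

(** * Uniform separation by Lipschitz functions *)

Section Separation.
Context {R : realType} {M : metricType R}.
Implicit Types (u v k : M -> R) (x y : M).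
Local Notation d := (@mdist R M).
Local Notation betaM := (set_type (@betaM_set R M)).
Variables (x0 : M) (i : nat).

(** A class closed under finite minima and maxima, which makes families of separating functions
    directed. *)
Definition unit_lip u := lip1 u /\ forall x, 0 <= u x <= 1.

Lemma UCb_unit_lip u : unit_lip u -> UCb u.
Proof. by move=> [ul /(UCb_lip1 ul)]. Qed.

Lemma unit_lip_min u v : unit_lip u -> unit_lip v ->
  unit_lip (fun x => Num.min (u x) (v x)).
Proof.
move=> [ul u01] [vl v01]; split=> [x y|x].
  have := ul x y; have := vl x y; rewrite !ler_norml => /andP[? ?] /andP[? ?].
  by rewrite /Num.min; do !case: ltP => ?; apply/andP; split; lra.
by rewrite /Num.min; case: ifP.
Qed.

Lemma unit_lip_max u v : unit_lip u -> unit_lip v ->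
  unit_lip (fun x => Num.max (u x) (v x)).
Proof.
move=> [ul u01] [vl v01]; split=> [x y|x].
  have := ul x y; have := vl x y; rewrite !ler_norml => /andP[? ?] /andP[? ?].
  by rewrite /Num.max; do !case: ltP => ?; apply/andP; split; lra.
by rewrite /Num.max; case: ifP.
Qed.

Lemma unit_lip_cst (c : R) : 0 <= c <= 1 -> unit_lip (fun=> c).
Proof. by move=> c01; split => // x y; rewrite subrr normr0 mdist_ge0. Qed.

Lemma mev_proj_continuous u :
  continuous (fun a : betaM => mev (proj_ext i a) u : R^o).
Proof.
move=> a; apply: (@continuous_comp _ _ _ _ (fun xi => mev xi u) a).
  exact: proj_ext_continuous.
exact: mev_continuous.
Qed.

(** The gap between [r] and [2 * r] survives truncation: (u - r)^+ vanishes near the projection of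
    [K] and still exceeds [r] at that of [a]. *)
Definition separated (K : set betaM) (r : R) : set betaM :=
  [set a | exists u, [/\ unit_lip u, 2 * r < mev (proj_ext i a) u &
    forall b, K b -> mev (proj_ext i b) u < r]].

Lemma separated_open K r : open (separated K r).
Proof.
rewrite (_ : separated K r = \bigcup_(u in
    [set u | unit_lip u /\ forall b, K b -> mev (proj_ext i b) u < r])
  ((fun a => mev (proj_ext i a) u) @^-1` [set t : R^o | 2 * r < t])).
  apply: bigcup_open => u _; apply: open_comp; last exact: open_gt.
  by move=> a _; exact: mev_proj_continuous.
apply/seteqP; split=> a; first by move=> [u [? ? ?]]; exists u.
by move=> [u [? ?] ?]; exists u.
Qed.

(** With [a] fixed, minima keep the bound at [a] and enlarge the open set where the value is below
    [r], until it contains [K]. *)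
Lemma separated_point (K : set betaM) (r : R) a : compact K -> 2 * r < 1 ->
  (forall b, K b -> exists u, [/\ unit_lip u, 2 * r < mev (proj_ext i a) u &
    mev (proj_ext i b) u < r]) ->
  separated K r a.
Proof.
move=> Kc r1 Kb; have alg := @UCb_alg R M.
pose D := [set u | unit_lip u /\ 2 * r < mev (proj_ext i a) u].
pose U u : set betaM := (fun b => mev (proj_ext i b) u) @^-1` [set t : R^o | t < r].
have [||u v [ul ua] [vl va]|b /Kb[u [? ? ?]]|u [ul ua] KU] :=
    @compact_directed_cover _ _ K D U Kc.
(* The constant 1 belongs to the family because [2 * r < 1]. *)
- exists (fun=> 1); split; first by apply: unit_lip_cst; rewrite ler01 lexx.
  by rewrite (char_cst alg (mev_char _)).
- move=> u _; apply: open_comp; last exact: open_lt.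
  by move=> b _; exact: mev_proj_continuous.
- have wl := unit_lip_min ul vl; have [[Uu Uv] Uw] :=
    (UCb_unit_lip ul, UCb_unit_lip vl, UCb_unit_lip wl).
  have mevw xi := char_min alg (mev_char xi) Uu Uv Uw (fun=> erefl).
  exists (fun x => Num.min (u x) (v x)); split.
  + by split=> //; rewrite mevw lt_min ua.
  + by move=> b; rewrite /U /= mevw gt_min => ->.
  + by move=> b; rewrite /U /= mevw gt_min => ->; rewrite orbT.
- by exists u.
- by exists u; split.
Qed.

(** Dual to [separated_point]: maxima keep the bound on [K] and enlarge the open set where the value
    exceeds [2 * r], until it contains [L]. *)
Lemma separated_compact (K L : set betaM) (r : R) : compact L -> 0 < r ->
  L `<=` separated K r ->
  exists u, [/\ unit_lip u, forall a, L a -> 2 * r < mev (proj_ext i a) u &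
    forall b, K b -> mev (proj_ext i b) u < r].
Proof.
move=> Lc r0 LK; have alg := @UCb_alg R M.
pose D := [set u | unit_lip u /\ forall b, K b -> mev (proj_ext i b) u < r].
pose U u : set betaM :=
  (fun b => mev (proj_ext i b) u) @^-1` [set t : R^o | 2 * r < t].
have [||u v [ul ua] [vl va]|b /LK[u [? ? ?]]|u [ul ua] KU] :=
    @compact_directed_cover _ _ L D U Lc.
- exists (fun=> 0); split; first by apply: unit_lip_cst; rewrite ler01 lexx.
  by move=> b _; rewrite (char_cst alg (mev_char _)).
- move=> u _; apply: open_comp; last exact: open_gt.
  by move=> b _; exact: mev_proj_continuous.
- have wl := unit_lip_max ul vl; have [[Uu Uv] Uw] :=
    (UCb_unit_lip ul, UCb_unit_lip vl, UCb_unit_lip wl).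
  have mevw xi := char_max alg (mev_char xi) Uu Uv Uw (fun=> erefl).
  exists (fun x => Num.max (u x) (v x)); split.
  + by split=> // b Kb; rewrite mevw gt_max ua// va.
  + by move=> b; rewrite /U /= mevw lt_max => ->.
  + by move=> b; rewrite /U /= mevw lt_max => ->; rewrite orbT.
- by exists u.
- by exists u; split.
Qed.

Lemma separated_test (K L : set betaM) (r : R) : compact L -> 0 < r ->
  L `<=` separated K r -> (forall a, L a -> r < decay2 x0 a) ->
  exists g, [/\ Gset g, forall a, 0 <= g a <= 1, forall a, K a -> g a = 0 &
    forall a, L a -> r * r <= g a].
Proof.
move=> Lc r0 LK Lr; have [u [uL ua ub]] := separated_compact Lc r0 LK.
have uu := UCb_unit_lip uL; have [ul u01] := uL.
(* The extension of [k] exceeds [r] on [L], so [bev_quot_ge] bounds the test function below by [r]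
   times [decay2], hence by [r * r]. *)
pose k x := Num.max 0 (u x - r).
have kl : lip1 k.
  move=> x y; have := ul x y; rewrite /k !ler_norml => /andP[? ?].
  by rewrite /Num.max; do !case: ltP => ?; apply/andP; split; lra.
have k01 x : 0 <= k x <= 1.
  rewrite le_max lexx ge_max ler01 /=; have /andP[_] := u01 x; lra.
have k0 x : 0 <= k x by have /andP[] := k01 x.
have hc : continuous (fun t : R => Num.max 0 (t - r)).
  move=> t; apply: (@continuous_max R R^o (fun=> 0) (fun t => t - r)).
    exact: cst_continuous.
  by apply: cvgB; [exact: cvg_id|exact: cvg_cst].
exists (fun a => bev a (quot i k)); split.
- exact: quot_Gset.
- by move=> a; exact: bev_quot_ge0.
- move=> a /ub; apply: bev_quot_eq0 => // x xr.
  by rewrite /k max_l// subr_le0 ltW.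
- move=> a La; apply: le_trans (bev_quot_ge x0 i a k01 kl).
  rewrite (char_comp (@UCb_alg R M) (mev_char _) hc uu (UCb_lip1 kl k01))//.
  apply: ler_pM; rewrite ?(ltW r0)//; last exact/ltW/Lr.
  by rewrite le_max; apply/orP; right; have := ua _ La; lra.
Qed.

End Separation.

(** * Inner regularity and the conclusion *)

Lemma Rcal_measurable {R : realType} {M : metricType R}
    (pt : set_type (@betaM_set R M)) (x0 : M) :
  measurable (Rcal x0 : set (g_sigma_algebraType (T := betaP pt)
    (@open (set_type (@betaM_set R M))))).
Proof.
apply: open_measurable_beta.
rewrite (_ : Rcal x0 = (proj_ext 1 @^-1` RM x0) `&` (proj_ext 2 @^-1` RM x0)).
  apply: openI; apply: open_comp; try exact: RM_open.
    by move=> a _; exact: proj_ext_continuous.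
  by move=> a _; exact: proj_ext_continuous.
apply/seteqP; split=> a; first by move/RcalP => [? ?]; split; apply/RMP.
by move=> [/RMP ? /RMP ?]; apply/RcalP.
Qed.

(** Inner regularity bounds the measure of [C] minus [K] by [e]; the rest of the complement of [K]
    lies outside [C], where [nu] vanishes. *)
Lemma Radon_inner {R : realType} {M : metricType R} (pt : set_type (@betaM_set R M))
    (nu : {measure set (g_sigma_algebraType (T := betaP pt)
      (@open (set_type (@betaM_set R M)))) -> \bar R})
    (C : set (g_sigma_algebraType (T := betaP pt)
      (@open (set_type (@betaM_set R M))))) (e : R) :
  is_Radon nu -> measurable C -> nu (~` C) = 0%E -> 0 < e ->
  exists K : set (set_type (@betaM_set R M)),
    [/\ compact K, K `<=` C & (nu (~` K) <= e%:E)%E].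
Proof.
move=> [nufin nureg] mC nuC e0.
have fin A : measurable A -> (nu A < +oo)%E.
  by move=> mA; apply: le_lt_trans nufin; apply: le_measure; rewrite ?inE.
have finC : nu C \is a fin_num by rewrite ge0_fin_numE// fin.
have [_ [K [Kc KC] <-]] := @ub_ereal_sup_adherent _
  [set nu K | K in [set K | @compact (set_type (@betaM_set R M)) K /\ K `<=` C]]
  _ e0 (eq_ind _ (fun t => t \is a fin_num) finC _ (nureg C mC)).
rewrite -nureg// => CK; exists K; split => //.
have mK := compact_measurable_beta Kc.
have -> : ~` K = (C `\` K) `|` ~` C.
  apply/seteqP; split => [a Ka|a [[]//|Ca Ka]]; last exact/Ca/KC.
  by have [Ca|Ca] := pselect (C a); [left|right].
apply: le_trans (measureU2 _ _ _) _.
- exact: measurableD.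
- exact: measurableC.
rewrite [X in (_ + X)%E]nuC adde0 measureD ?fin//.
rewrite (_ : C `&` K = K); last exact/setIidr.
have finK : nu K \is a fin_num by rewrite ge0_fin_numE// fin.
have sub_le (x y : \bar R) : x \is a fin_num -> y \is a fin_num ->
    (x - e%:E < y -> x - y <= e%:E)%E.
  by move=> /fineK<- /fineK<-; rewrite -!EFinB lte_fin lee_fin; lra.
exact: sub_le finC finK CK.
Qed.

Theorem theorem3p28 (R : realType) (M : metricType R) (x0 : M)
  (three_points : exists a b c : M, [/\ a <> b, b <> c & a <> c])
  (M_complete : forall F : set_system M, ProperFilter F -> cauchy F -> exists x : M, F --> x)
  (E : set (set_type (@Mu_set R M)))
  (E_Borel : Borel_in_RM x0 E) (E_closed : dbar_closed x0 E)
  (i : nat) (hi : i = 1%N \/ i = 2%N)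
  (pt : set_type (@betaM_set R M)) :
  frakC (pt := pt) (Rcal x0 `&` preim_p i E).
Proof.
have mR := @Rcal_measurable R M pt x0.
have mC : measurable (Rcal x0 `&` preim_p i E :
    set (g_sigma_algebraType (T := betaP pt)
      (@open (set_type (@betaM_set R M))))).
  by apply: measurableI => //; exact: preim_measurable E_Borel.
split=> // mu nu muR nuR mn nuC.
have /choice[K KP] : forall n : nat, exists K : set (set_type (@betaM_set R M)),
    [/\ compact K, K `<=` Rcal x0 `&` preim_p i E &
        (nu (~` K) <= (n.+1%:R^-1)%:E)%E].
  by move=> n; exact: Radon_inner.
have Kc n : compact (K n) by have [] := KP n.
have KC n : K n `<=` Rcal x0 `&` preim_p i E by have [] := KP n.
have nuK n : (nu (~` K n) <= (n.+1%:R^-1)%:E)%E by have [] := KP n.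
(* [N] depends on [n], but the lower bound 1 off [Rcal] does not, as [prec_null] requires. *)
have muRcal : mu (~` Rcal x0) = 0%E.
  apply: (prec_null mn Kc nuK _ ltr01); first exact: measurableC.
  move=> n; have [N N0 NK] := far_compact (Kc n) (subset_trans (KC n) (@subIsetl _ _ _)).
  exists (fun a => bev a (quot 1 (far x0 N)) + bev a (quot 2 (far x0 N))); split.
  - by apply: Gset_add; apply: quot_Gset; [exact: far_ge0|exact: far_lip1|
      exact: far_ge0|exact: far_lip1].
  - move=> a.
    have /andP[? ?] := bev_quot_ge0 1 a (far_ge0 x0 N) (@far_lip1 _ _ x0 N).
    have /andP[? ?] := bev_quot_ge0 2 a (far_ge0 x0 N) (@far_lip1 _ _ x0 N).
    by apply/andP; split; lra.
  - exact: NK.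
  - by move=> a; exact: far_ge1.
(* Starting at 1/3 ensures [2 * r m < 1], as [separated_point] requires. *)
pose r (m : nat) : R := m.+3%:R^-1.
have r0 m : 0 < r m by rewrite invr_gt0.
have r1 m : 2 * r m < 1 by rewrite ltr_pdivrMr// mul1r ltr_nat.
pose B m : set (set_type (@betaM_set R M)) :=
  (\bigcap_n separated i (K n) (r m)) `&` [set a | r m < decay2 x0 a].
have mB m : measurable (B m : set (g_sigma_algebraType (T := betaP pt)
      (@open (set_type (@betaM_set R M))))).
  apply: measurableI.
    apply: bigcapT_measurable => n; apply: open_measurable_beta.
    exact: separated_open.
  apply: open_measurable_beta.
  apply: (@open_comp _ R^o (decay2 x0) [set t | r m < t]); last exact: open_gt.
  by move=> a _; exact: decay2_continuous.
(* [B m] need not be compact, while [separated_test] works on compact sets; inner regularity of [mu]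
   reduces the claim to them. *)
have muB m : mu (B m) = 0%E.
  apply/eqP; rewrite eq_le measure_ge0 andbT muR.2//.
  apply: ge_ereal_sup => _ [L [Lc LB] <-].
  rewrite (prec_null mn Kc nuK _ (mulr_gt0 (r0 m) (r0 m)))//.
    exact: compact_measurable_beta.
  move=> n; have [g [Gg g01 gK gL]] := separated_test (K := K n) Lc (r0 m)
    (fun a La => (LB a La).1 n I) (fun a La => (LB a La).2).
  by exists g; split => // a; have /andP[-> /= /le_trans->] := g01 a; rewrite ?ler1n.
have cover : ~` (Rcal x0 `&` preim_p i E) `<=` ~` Rcal x0 `|` \bigcup_m B m.
  move=> a aC; have [aR|] := pselect (Rcal x0 a); last by left.
  right; pose xi := proj_ext i a.
  have xiR : RM x0 xi.
    by have /RcalP[p q] := aR; apply/RMP; rewrite /xi; case: hi => ->.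
  have xiE : ~ E xi by move=> Exi; apply: aC; split => //; rewrite preim_pE.
  have [e e0 far_E] : exists2 e : R, 0 < e & forall eta, E eta ->
      (e%:E <= dbar x0 xi eta)%E.
    apply: contrapT => noe; apply: xiE; apply: E_closed.2 => // e e0.
    apply: contrapT => noeta; apply: noe; exists e => // eta Eeta.
    by rewrite leNgt; apply/negP => lt_e; apply: noeta; exists eta.
  (* If [r m < t], then [r m] is below [decay2] at [a] and [2 * r m] below the bound of
     [dbar_separation]. Neither bound involves [n], so one [m] serves every [K n]. *)
  pose t : R := Num.min (decay2 x0 a) (Num.min 1 (e / 2) / 2).
  have t0 : 0 < t.
    by rewrite lt_min decay2_gt0//= divr_gt0// lt_min ltr01 divr_gt0.
  have [m mt] := filter_ex (near_infty_natSinv_lt (PosNum t0)).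
  have {mt} rt : r m < t.
    apply: le_lt_trans mt; rewrite lef_pV2 ?posrE// ler_nat.
    by rewrite ltnS ltnW.
  move: rt; rewrite lt_min => /andP[r_decay r_e].
  exists m => //; split => // n _; apply: separated_point => // b Kb.
  have [_ /=] := KC n b Kb; rewrite preim_pE => Eb.
  have [u [ul u01 u0 ue]] :=
    dbar_separation e0 xiR (E_closed.1 _ Eb) (far_E _ Eb).
  exists u; split => //; last by rewrite u0.
  by apply: lt_le_trans ue; rewrite mulrC -ltr_pdivlMr.
apply: measure_negligible; first exact: measurableC.
apply: (@negligibleS _ _ _ mu _ _ cover); apply: negligibleU.
  by exists (~` Rcal x0); split => //; apply: measurableC.
by apply: negligible_bigcup => m; exists (B m); split.
Qed.
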